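(* Let $X$ be a locally 1-connected space and let $p\colon Y\to X$ be a semilocally 1-connected (sl1c) map. Then multiplication (composition) in the vertical fundamental groupoid $\Pi_1^{vert}(p)$, i.e. the map $\Pi_1^{vert}(p)_1\times_Y \Pi_1^{vert}(p)_1\to \Pi_1^{vert}(p)_1$, $([f],[g])\mapsto [fg]$, defined on pairs with $t[f]=s[g]$ by concatenation of paths, is continuous.
   Context: $I=[0,1]$. ''Basic open neighbourhoods'' are members of a chosen basis of the topology. A space is locally 1-connected if it has an open neighbourhood basis of 1-connected (path-connected and simply connected) sets; for such a base space $X$, the basic open sets of $X$ are taken to be 1-connected. A map $p\colon Y\to X$ is semilocally 1-connected (sl1c) if for all $y\in Y$ there are a basic open neighbourhood $U$ of $p(y)$ and a basic open neighbourhood $N$ of $y$ with $p(N)\subset U$ such that: for every map $b\colon\partial I^2\to N$ and every map $c\colon I^2\to U$ with $c|_{\partial I^2}=p\circ b$, there is a map $\ell\colon I^2\to U\times_X Y=p^{-1}(U)$ with $p\circ\ell=c$ and $\ell|_{\partial I^2}=b$. Vertical fundamental groupoid $\Pi_1^{vert}(p)$: the object space is $Y$. Arrows are classes $[f]$ of vertical paths $f\colon I\to Y$ (paths with $p\circ f$ constant) modulo vertical homotopy (homotopy through vertical paths) relative to $\{0,1\}$. Source $s$ and target $t$ are evaluation at $0$ and $1$, units are constant paths, inversion is path reversal, composition is concatenation. Write $p[f]$ for the common value of $p\circ f$. The topology on the set of arrows $\Pi_1^{vert}(p)_1$ has as basic open neighbourhoods of $[f]$ the sets $$\langle [f],U,V_0,V_1\rangle=\{[g]\mid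 \exists\, h\colon I^2\to p^{-1}(U),\ h(0,-)=f,\ h(1,-)=g,\ h(t,\epsilon)\in V_\epsilon \text{ for all } t\in I,\ \epsilon=0,1\},$$ where $U\subset X$ is a basic open neighbourhood of $p[f]$ and $V_0,V_1\subset Y$ are basic open neighbourhoods of $s[f]$, $t[f]$ respectively. *)

(* Defs.v *)
From HB Require Import structures.
From mathcomp Require Import all_boot all_order all_algebra generic_quotient.
From mathcomp Require Import mathcomp_extra boolp classical_sets functions.
From mathcomp Require Import set_interval reals topology normedtype lra.

Set Implicit Arguments.
Unset Strict Implicit.
Unset Printing Implicit Defensive.

Import Order.TTheory GRing.Theory Num.Theory numFieldNormedType.Exports.

Local Open Scope classical_set_scope.
Local Open Scope ring_scope.
Local Open Scope quotient_scope.

Section unit_square.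
Context (R : realType).

Definition I01 : set R := `[0, 1]%classic.
Definition I2 : set (R * R) := I01 `*` I01.
Definition bdI2 : set (R * R) :=
  I2 `&` [set z | [\/ z.1 = 0, z.1 = 1, z.2 = 0 | z.2 = 1]].

End unit_square.
Arguments I01 {R}.
Arguments I2 {R}.
Arguments bdI2 {R}.

(* A map from the subspace A of S to the subspace B of T is represented by a
   total function S -> T; only its values on A are meaningful. *)
Definition map_on (S T : topologicalType) (A : set S) (B : set T) (f : S -> T)
  : Prop := {within A, continuous f} /\ (forall x, A x -> B (f x)).

Record open_basis (T : topologicalType) := OpenBasis {
  basic :> set T -> Prop;
  basicP : basis basic
}.

Section one_connected.
Context (R : realType) (T : topologicalType).

Definition path_connected (A : set T) : Prop :=
  forall x y, A x -> A y ->
  exists f : R -> T, [/\ map_on I01 A f, f 0 = x & f 1 = y].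

Definition simply_connected (A : set T) : Prop :=
  forall f : R -> T, map_on I01 A f -> f 0 = f 1 ->
  exists h : R * R -> T,
    [/\ map_on I2 A h,
        (forall u, I01 u -> h (0, u) = f u),
        (forall u, I01 u -> h (1, u) = f 0) &
        (forall t, I01 t -> h (t, 0) = f 0 /\ h (t, 1) = f 0)].

Definition one_connected (A : set T) : Prop :=
  path_connected A /\ simply_connected A.

(* A space is locally 1-connected when it has such a basis, which is then the
   one used for its basic open sets. *)
Definition locally_one_connected (B : open_basis T) : Prop :=
  forall U, B U -> one_connected U.

End one_connected.

Definition sl1c (R : realType) (X Y : topologicalType)
    (BX : open_basis X) (BY : open_basis Y) (p : Y -> X) : Prop :=
  forall y : Y, exists (U : set X) (N : set Y),
    [/\ BX U, U (p y), BY N, N y & forall z, N z -> U (p z)] /\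
    forall (b : R * R -> Y) (c : R * R -> X),
      map_on bdI2 N b -> map_on I2 U c ->
      (forall z, bdI2 z -> c z = p (b z)) ->
      exists l : R * R -> Y,
        [/\ map_on I2 (p @^-1` U) l,
            (forall z, I2 z -> p (l z) = c z) &
            (forall z, bdI2 z -> l z = b z)].

Section gluing.
Context (R : realType).

Lemma I01E (x : R) : I01 x = ((0 <= x) && (x <= 1)) :> Prop.
Proof. by rewrite /I01 /= in_itv. Qed.

Lemma I01_0 : I01 (0 : R). Proof. by rewrite I01E lexx ler01. Qed.
Lemma I01_1 : I01 (1 : R). Proof. by rewrite I01E lexx ler01. Qed.

Lemma within_comp (S T U : topologicalType) (A : set S) (B : set T)
    (g : S -> T) (f : T -> U) :
  {within A, continuous g} -> (forall x, A x -> B (g x)) ->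
  {within B, continuous f} -> {within A, continuous (f \o g)}.
Proof.
move=> /subspace_continuousP cg gAB /subspace_continuousP cf.
apply/subspace_continuousP => x Ax W nW.
have := cf _ (gAB _ Ax) _ nW; rewrite /= /nbhs /= => BW.
have := cg _ Ax _ BW; rewrite /= /nbhs /= /within /=.
by apply: filterS => z /= + Az => /(_ Az); apply; exact: gAB.
Qed.

Lemma pair_continuous (S T U : topologicalType) (f : S -> T) (g : S -> U) :
  continuous f -> continuous g -> continuous (fun x => (f x, g x)).
Proof. by move=> cf cg x; apply: cvg_pair; [exact: cf|exact: cg]. Qed.

Lemma affine_fst_continuous (a b : R) :
  continuous (fun z : R * R => (a * z.1 + b, z.2)).
Proof.
apply: pair_continuous => z; last exact: cvg_snd.
apply: cvgD; last exact: cvg_cst.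
by apply: cvgM; [exact: cvg_cst|exact: cvg_fst].
Qed.

(* Concatenation, at the middle of the first coordinate. *)
Definition hglue (T : Type) (h k : R * R -> T) (z : R * R) : T :=
  if z.1 <= 2^-1 then h (2 * z.1, z.2) else k (2 * z.1 - 1, z.2).

Lemma hglueP t : I01 t ->
  exists2 s, I01 s &
    (forall T (h k : R * R -> T) u, hglue h k (t, u) = h (s, u)) \/
    (forall T (h k : R * R -> T) u, hglue h k (t, u) = k (s, u)).
Proof.
rewrite I01E => /andP[t0 t1]; rewrite /hglue /=.
have [le|lt] := leP t 2^-1.
  by exists (2 * t); [rewrite I01E mulr_ge0//= -ler_pdivlMl// mulr1|left].
exists (2 * t - 1); last by right.
by rewrite I01E subr_ge0 -ler_pdivrMl// mulr1 ltW//=; lra.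
Qed.

Lemma hglue_in (T : Type) (A : set T) (h k : R * R -> T) :
  (forall z, I2 z -> A (h z)) -> (forall z, I2 z -> A (k z)) ->
  forall z, I2 z -> A (hglue h k z).
Proof.
move=> hA kA [t u] [/= It Iu].
by have [s Is [->|->]] := hglueP It; [exact: hA|exact: kA].
Qed.

Lemma hglue0 (T : Type) (h k : R * R -> T) u : hglue h k (0, u) = h (0, u).
Proof. by rewrite /hglue /= invr_ge0 ler0n mulr0. Qed.

Lemma hglue1 (T : Type) (h k : R * R -> T) u : hglue h k (1, u) = k (1, u).
Proof.
rewrite /hglue /= leNgt invf_lt1 ?ltr1n//= mulr1.
by rewrite (_ : 2 - 1 = 1)// -[2]/(1 + 1) addrK.
Qed.

Lemma hglue_continuous (T : topologicalType) (h k : R * R -> T) :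
  {within I2, continuous h} -> {within I2, continuous k} ->
  (forall u, I01 u -> h (1, u) = k (0, u)) ->
  {within I2, continuous (hglue h k)}.
Proof.
move=> ch ck hk.
have cL : closed [set z : R * R | z.1 <= 2^-1].
  apply: (@closed_comp _ _ fst [set x : R | x <= 2^-1]); last exact: closed_le.
  by move=> z _; exact: cvg_fst.
have cR : closed [set z : R * R | z.1 >= 2^-1].
  apply: (@closed_comp _ _ fst [set x : R | x >= 2^-1]); last exact: closed_ge.
  by move=> z _; exact: cvg_fst.
have cI : closed (I2 : set (R * R)).
  have -> : (I2 : set (R * R)) = fst @^-1` I01 `&` snd @^-1` I01 by [].
  apply: closedI; apply: closed_comp; try exact: interval_closed.
    by move=> z _; exact: cvg_fst.
  by move=> z _; exact: cvg_snd.
have -> : (I2 : set (R * R)) =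
    (I2 `&` [set z | z.1 <= 2^-1]) `|` (I2 `&` [set z | z.1 >= 2^-1]).
  rewrite -setIUr; apply/seteqP; split => [z Iz|z []//]; split => //=.
  by case: (leP z.1 2^-1) => [|/ltW]; [left|right].
apply: withinU_continuous; [exact: closedI|exact: closedI| |].
- apply: (@subspace_eq_continuous _ _ _ (h \o (fun z => (2 * z.1 + 0, z.2)))).
    by move=> [t u]; rewrite inE => -[_ /= tle]; rewrite /from_subspace /hglue /= addr0 tle.
  apply: (within_comp _ _ ch).
    by apply: continuous_subspaceT; exact: affine_fst_continuous.
  move=> [t u] [[/= + Iu]]; rewrite I01E => /andP[t0 _] t1; split => //=.
  by rewrite I01E addr0 mulr_ge0//= -ler_pdivlMl// mulr1.
- apply: (@subspace_eq_continuous _ _ _ (k \o (fun z => (2 * z.1 - 1, z.2)))).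
    move=> [t u]; rewrite inE => -[[/= _ Iu] tge].
    rewrite /from_subspace /hglue /=.
    case: leP => // tle; have -> : t = 2^-1 by apply/eqP; rewrite eq_le tle.
    by rewrite mulfV ?pnatr_eq0// subrr hk.
  apply: (within_comp _ _ ck).
    by apply: continuous_subspaceT; exact: affine_fst_continuous.
  move=> [t u] [[/= + Iu]]; rewrite I01E => /andP[_ t1] t0; split => //=.
  by rewrite I01E subr_ge0 -ler_pdivrMl// mulr1 t0/=; lra.
Qed.

Lemma I2_swap (z : R * R) : I2 z -> I2 (swap_pair z).
Proof. by case: z => t u [/= It Iu]; split. Qed.

Lemma vglue_continuous (T : topologicalType) (h k : R * R -> T) :
  {within I2, continuous h} -> {within I2, continuous k} ->
  (forall t, I01 t -> h (t, 1) = k (t, 0)) ->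
  {within I2, continuous (hglue (h \o @swap_pair R R) (k \o @swap_pair R R) \o @swap_pair R R)}.
Proof.
move=> ch ck hk.
have cs : {within I2, continuous (@swap_pair R R)}.
  by apply: continuous_subspaceT; exact: swap_continuous.
apply: (within_comp cs I2_swap); apply: hglue_continuous.
- exact: within_comp cs I2_swap ch.
- exact: within_comp cs I2_swap ck.
- by move=> t It; exact: hk.
Qed.

Lemma lift_fst_continuous (T : topologicalType) (f : R -> T) :
  {within I01, continuous f} -> {within I2, continuous (f \o @fst R R)}.
Proof.
move=> cf; apply: within_comp cf; last by move=> z [].
by apply: continuous_subspaceT => z; exact: cvg_fst.
Qed.

Lemma lift_snd_continuous (T : topologicalType) (f : R -> T) :
  {within I01, continuous f} -> {within I2, continuous (f \o @snd R R)}.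
Proof.
move=> cf; apply: within_comp cf; last by move=> z [].
by apply: continuous_subspaceT => z; exact: cvg_snd.
Qed.

End gluing.

Section vertical_paths.
Context (R : realType) (X Y : topologicalType) (p : Y -> X).

(* Two paths with the same values on [0,1] are vertically homotopic, so the
   values outside [0,1] disappear in the set of arrows. *)
Record vpath := VPath {
  vfun :> R -> Y;
  vpath_continuous : {within I01, continuous vfun};
  vpath_vertical : exists x : X, forall u, I01 u -> p (vfun u) = x
}.

Arguments vpath_continuous : clear implicits.
Arguments vpath_vertical : clear implicits.

HB.instance Definition _ := gen_eqMixin vpath.
HB.instance Definition _ := gen_choiceMixin vpath.

Definition vhomotopic (f g : vpath) : Prop :=
  exists h : R * R -> Y,
    [/\ {within I2, continuous h},
        (forall u, I01 u -> h (0, u) = f u),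
        (forall u, I01 u -> h (1, u) = g u),
        (forall t, I01 t -> exists x : X, forall u, I01 u -> p (h (t, u)) = x) &
        (forall t, I01 t -> h (t, 0) = f 0 /\ h (t, 1) = f 1)].

Lemma vpathE (f : vpath) u : I01 u -> p (f u) = p (f 0).
Proof.
have [x fx] := vpath_vertical f => Iu.
by rewrite !fx//; exact: I01_0.
Qed.

Lemma vhomotopic_refl f : vhomotopic f f.
Proof.
exists (f \o @snd R R); split => //.
- exact: lift_snd_continuous (vpath_continuous f).
- by move=> t _; exact: vpath_vertical.
Qed.

Lemma vhomotopic_ends f g : vhomotopic f g -> f 0 = g 0 /\ f 1 = g 1.
Proof.
case=> h [_ _ hg _ he]; have [<- <-] := he _ (I01_1 R).
by split; apply: hg; [exact: I01_0|exact: I01_1].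
Qed.

Lemma vhomotopic_sym f g : vhomotopic f g -> vhomotopic g f.
Proof.
move=> fg; have [e0 e1] := vhomotopic_ends fg.
case: fg => h [ch hf hg hv he].
have onemI (t : R) : I01 t -> I01 (1 - t).
  by rewrite !I01E => /andP[t0 t1]; rewrite subr_ge0 t1 gerBl t0.
exists (h \o (fun z => (- 1 * z.1 + 1, z.2))); split => /=.
- apply: (within_comp _ _ ch).
    by apply: continuous_subspaceT; exact: affine_fst_continuous.
  by move=> [t u] [/= /onemI It Iu]; split => //=; rewrite mulN1r addrC.
- by move=> u Iu; rewrite mulr0 add0r hg.
- by move=> u Iu; rewrite mulN1r addNr hf.
- by move=> t /onemI; rewrite mulN1r addrC; exact: hv.
- by move=> t /onemI/he; rewrite e0 e1 mulN1r addrC.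
Qed.

Lemma vhomotopic_trans g f k :
  vhomotopic f g -> vhomotopic g k -> vhomotopic f k.
Proof.
move=> fg; have [e0 e1] := vhomotopic_ends fg.
case: fg => h [ch hf hg hv he] [h' [ch' hf' hg' hv' he']].
exists (hglue h h'); split.
- by apply: hglue_continuous => // u Iu; rewrite hg// hf'.
- by move=> u Iu; rewrite hglue0 hf.
- by move=> u Iu; rewrite hglue1 hg'.
- by move=> t It; have [s Is [E|E]] := hglueP It;
    [have [x hx] := hv _ Is|have [x hx] := hv' _ Is];
    exists x => u Iu; rewrite E hx.
- move=> t It; have [s Is [E|E]] := hglueP It; rewrite !E; first exact: he.
  by rewrite e0 e1; exact: he'.
Qed.

Definition vhomotopicb (f g : vpath) : bool := `[< vhomotopic f g >].

Lemma vhomotopicb_refl : reflexive vhomotopicb.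
Proof. by move=> f; apply/asboolP; exact: vhomotopic_refl. Qed.

Lemma vhomotopicb_sym : symmetric vhomotopicb.
Proof.
by move=> f g; apply/asboolP/asboolP; exact: vhomotopic_sym.
Qed.

Lemma vhomotopicb_trans : transitive vhomotopicb.
Proof.
move=> g f k /asboolP fg /asboolP gk; apply/asboolP.
exact: vhomotopic_trans fg gk.
Qed.

Canonical vhomotopic_equiv :=
  EquivRel vhomotopicb vhomotopicb_refl vhomotopicb_sym vhomotopicb_trans.

End vertical_paths.
Arguments vpath_continuous {R X Y p} _.
Arguments vpath_vertical {R X Y p} _.

Section arrows.
Context (R : realType) (X Y : topologicalType).
Context (BX : open_basis X) (BY : open_basis Y) (p : Y -> X).
Local Notation vpath := (vpath R p).

(* The set of arrows; the chosen bases are parameters because they define its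
   topology. *)
Definition vpi1 : Type := let _ := (BX, BY) in {eq_quot vhomotopic_equiv R p}.

HB.instance Definition _ := Choice.on vpi1.
HB.instance Definition _ := Quotient.on vpi1.

Definition vclass (f : vpath) : vpi1 := \pi_vpi1 f.

Lemma vclassP (f g : vpath) : vclass f = vclass g <-> vhomotopic f g.
Proof.
rewrite /vclass; split => [/eqmodP/asboolP //|fg].
by apply/eqmodP/asboolP.
Qed.

Lemma vclass_repr (a : vpi1) : vclass (repr a) = a.
Proof. exact: reprK. Qed.

Definition vpi1_nbhd (f : vpath) (U : set X) (V0 V1 : set Y) : set vpi1 :=
  [set vclass g | g in [set g : vpath | exists h : R * R -> Y,
    [/\ map_on I2 (p @^-1` U) h,
        (forall u, I01 u -> h (0, u) = f u),
        (forall u, I01 u -> h (1, u) = g u) &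
        (forall t, I01 t -> V0 (h (t, 0)) /\ V1 (h (t, 1)))]]].

Definition vpi1_basic : set (set vpi1) :=
  [set A | exists f U V0 V1,
    [/\ A = vpi1_nbhd f U V0 V1, BX U /\ U (p (f 0)),
        BY V0 /\ V0 (f 0) & BY V1 /\ V1 (f 1)]].

Lemma vpi1_nbhd_self (f : vpath) U V0 V1 :
  U (p (f 0)) -> V0 (f 0) -> V1 (f 1) -> vpi1_nbhd f U V0 V1 (vclass f).
Proof.
move=> Uf V0f V1f; exists f => //; exists (f \o @snd R R); split => //=.
split; first exact: lift_snd_continuous (vpath_continuous f).
by move=> z [_ Iz] /=; rewrite vpathE.
Qed.

Lemma vpi1_basic_cover : \bigcup_(A in vpi1_basic) A = setT.
Proof.
apply/seteqP; split => // a _; rewrite -(vclass_repr a).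
set f := repr a.
have bas (T : topologicalType) (B : open_basis T) (x : T) : exists V, B V /\ V x.
  by have [_ /(_ x setT filterT)[V BV _]] := basicP B; exists V.
have [U [BU Uf]] := bas _ BX (p (f 0)).
have [V0 [BV0 V0f]] := bas _ BY (f 0).
have [V1 [BV1 V1f]] := bas _ BY (f 1).
exists (vpi1_nbhd f U V0 V1); last exact: vpi1_nbhd_self.
by exists f, U, V0, V1.
Qed.

Lemma vpi1_nbhd_sub (f g : vpath) (U U' : set X) (V0 V0' V1 V1' : set Y) :
  vpi1_nbhd f U V0 V1 (vclass g) ->
  U' `<=` U -> V0' `<=` V0 -> V1' `<=` V1 ->
  vpi1_nbhd g U' V0' V1' `<=` vpi1_nbhd f U V0 V1.
Proof.
case=> k [h [[ch hU] hf hk hV]] /vclassP kg UU VV0 VV1.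
move=> _ [l [h2 [[ch2 hU2] hg hl hV2]] <-].
have [k0 k1] := vhomotopic_ends kg.
case: kg => h1 [ch1 h1k h1g h1v h1e].
have h1l u : I01 u -> h1 (1, u) = h2 (0, u) by move=> Iu; rewrite h1g// hg.
have Uk u : I01 u -> U (p (k u)).
  by move=> Iu; rewrite -hk//; apply: hU; split => //; exact: I01_1.
have h1U z : I2 z -> U (p (h1 z)).
  case: z => t u [/= It Iu]; have [x hx] := h1v _ It.
  rewrite hx// -(hx 0 (I01_0 R)).
  by have [-> _] := h1e _ It; apply: Uk; exact: I01_0.
have V0k : V0 (k 0).
  by rewrite -hk; [exact: (hV _ (I01_1 R)).1|exact: I01_0].
have V1k : V1 (k 1).
  by rewrite -hk; [exact: (hV _ (I01_1 R)).2|exact: I01_1].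
have glue_side (h3 h4 : R * R -> Y) (V : set Y) (e : R) : I01 e ->
    (forall t, I01 t -> V (h3 (t, e))) -> (forall t, I01 t -> V (h4 (t, e))) ->
    forall t, I01 t -> V (hglue h3 h4 (t, e)).
  move=> Ie hV3 hV4 t It.
  by have [s Is [->|->]] := hglueP It; [exact: hV3|exact: hV4].
exists l => //; exists (hglue h (hglue h1 h2)); split.
- split.
    apply: hglue_continuous => //; first exact: hglue_continuous.
    by move=> u Iu; rewrite hk// hglue0 h1k.
  apply: hglue_in => //; apply: hglue_in => // z Iz.
  by apply: UU; exact: hU2.
- by move=> u Iu; rewrite hglue0 hf.
- by move=> u Iu; rewrite !hglue1 hl.
- move=> t It; split.
    apply: (@glue_side) => //; first exact: I01_0.
      by move=> t' It'; have [] := hV _ It'.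
    apply: (@glue_side) => //; first exact: I01_0.
      by move=> t' It'; have [-> _] := h1e _ It'.
    by move=> t' It'; apply: VV0; have [] := hV2 _ It'.
  apply: (@glue_side) => //; first exact: I01_1.
    by move=> t' It'; have [] := hV _ It'.
  apply: (@glue_side) => //; first exact: I01_1.
    by move=> t' It'; have [_ ->] := h1e _ It'.
  by move=> t' It'; apply: VV1; have [] := hV2 _ It'.
Qed.

Lemma vpi1_basic_join (A B : set vpi1) (a : vpi1) :
  vpi1_basic A -> vpi1_basic B -> A a -> B a ->
  exists C, [/\ vpi1_basic C, C a & C `<=` A `&` B].
Proof.
move=> [f [U [V0 [V1 [-> [BU _] [BV0 _] [BV1 _]]]]]].
move=> [f' [U' [V0' [V1' [-> [BU' _] [BV0' _] [BV1' _]]]]]].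
rewrite -(vclass_repr a); set g := repr a => Ag Ag'.
have in_ends f1 W W0 W1 : vpi1_nbhd f1 W W0 W1 (vclass g) ->
    [/\ W (p (g 0)), W0 (g 0) & W1 (g 1)].
  case=> k [h [[_ hU] _ hk hV]] /vclassP/vhomotopic_ends[<- <-].
  have [V0k V1k] := hV _ (I01_1 R).
  rewrite -!hk; try exact: I01_0; try exact: I01_1.
  by split => //; apply: hU; split; [exact: I01_1|exact: I01_0].
have basI (T : topologicalType) (C : open_basis T) (V V' : set T) (x : T) :
    C V -> C V' -> V x -> V' x -> exists W, [/\ C W, W x & W `<=` V `&` V'].
  move=> CV CV' Vx V'x; have [Bo /(_ x (V `&` V'))] := basicP C.
  case; last by move=> W [CW Wx] WV; exists W.
  apply: filterI; apply: open_nbhs_nbhs; split => //; exact: Bo.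
have [Ug V0g V1g] := in_ends _ _ _ _ Ag.
have [Ug' V0g' V1g'] := in_ends _ _ _ _ Ag'.
have [U2 [BU2 U2g U2_]] := basI _ _ _ _ _ BU BU' Ug Ug'.
have [W0 [BW0 W0g W0_]] := basI _ _ _ _ _ BV0 BV0' V0g V0g'.
have [W1 [BW1 W1g W1_]] := basI _ _ _ _ _ BV1 BV1' V1g V1g'.
exists (vpi1_nbhd g U2 W0 W1); split.
- by exists g, U2, W0, W1.
- exact: vpi1_nbhd_self.
- by rewrite subsetI; split; apply: vpi1_nbhd_sub => // z;
    [move=> /U2_[]|move=> /W0_[]|move=> /W1_[]|move=> /U2_[]|move=> /W0_[]|move=> /W1_[]].
Qed.

HB.instance Definition _ := isBaseTopological.Build vpi1
  vpi1_basic_cover vpi1_basic_join.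

Definition vsource (a : vpi1) : Y := (repr a : vpath) 0.
Definition vtarget (a : vpi1) : Y := (repr a : vpath) 1.

Lemma vsource_class (f : vpath) : vsource (vclass f) = f 0.
Proof. by have /vclassP/vhomotopic_ends[] := vclass_repr (vclass f). Qed.

Lemma vtarget_class (f : vpath) : vtarget (vclass f) = f 1.
Proof. by have /vclassP/vhomotopic_ends[] := vclass_repr (vclass f). Qed.

Definition concat (f g : R -> Y) (u : R) : Y :=
  if u <= 2^-1 then f (2 * u) else g (2 * u - 1).

Lemma concat_continuous (f g : vpath) :
  f 1 = g 0 -> {within I01, continuous (concat f g)}.
Proof.
move=> fg; have -> : concat f g =
    hglue (f \o @fst R R) (g \o @fst R R) \o (fun u => (u, 0)) by [].
apply: within_comp; last first.
- apply: hglue_continuous (lift_fst_continuous (vpath_continuous f))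
    (lift_fst_continuous (vpath_continuous g)) _ => u _ /=; exact: fg.
- by move=> u Iu; split => //; exact: I01_0.
- apply: continuous_subspaceT; apply: pair_continuous => u; first exact: cvg_id.
  exact: cvg_cst.
Qed.

Lemma concat_vertical (f g : vpath) :
  f 1 = g 0 -> exists x : X, forall u, I01 u -> p (concat f g u) = x.
Proof.
move=> fg; exists (p (f 0)) => u Iu.
apply: (@hglue_in R _ [set y | p y = p (f 0)] (f \o @fst R R) (g \o @fst R R)
  _ _ (u, 0)).
- by move=> z [Iz _] /=; exact: vpathE.
- by move=> z [Iz _] /=; rewrite vpathE// -fg vpathE//; exact: I01_1.
- by split => //; exact: I01_0.
Qed.

Definition vconcat (f g : vpath) (fg : f 1 = g 0) : vpath :=
  VPath (concat_continuous fg) (concat_vertical fg).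

(* The fibre product of the set of arrows with itself over Y, with the subspace
   topology of the product. *)
Definition vcomposable : set (vpi1 * vpi1) :=
  [set ab | vtarget ab.1 = vsource ab.2].

Lemma vcomposable_repr (ab : vcomposable) :
  (repr (val ab).1 : vpath) 1 = (repr (val ab).2 : vpath) 0.
Proof. by have /set_mem := valP ab. Qed.

Definition vcomp (ab : vcomposable) : vpi1 :=
  vclass (vconcat (vcomposable_repr ab)).

Lemma vconcat_vhomotopic (f f' g g' : vpath)
    (f'g' : f' 1 = g' 0) (fg : f 1 = g 0) :
  vhomotopic f' f -> vhomotopic g' g ->
  vhomotopic (vconcat f'g') (vconcat fg).
Proof.
move=> ff' gg'.
have [f0 f1] := vhomotopic_ends ff'; have [g0 g1] := vhomotopic_ends gg'.
case: gg' ff' => h' [ch' h'0 h'1 h'v h'e] [h [ch h0 h1 hv he]].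
pose hh := hglue (h \o @swap_pair R R) (h' \o @swap_pair R R) \o @swap_pair R R.
have hhP t u : hh (t, u) =
    hglue (fun z => h (t, z.1)) (fun z => h' (t, z.1)) (u, 0) by [].
have concatP (k k' : R -> Y) u :
  concat k k' u = hglue (k \o @fst R R) (k' \o @fst R R) (u, 0) by [].
have ends t : I01 t -> h (t, 1) = h' (t, 0).
  by move=> It; rewrite (he _ It).2 (h'e _ It).1.
exists hh; split.
- exact: vglue_continuous.
- move=> u Iu; rewrite hhP [RHS]concatP.
  by have [s Is [E|E]] := hglueP Iu; rewrite !E /=; [exact: h0|exact: h'0].
- move=> u Iu; rewrite hhP [RHS]concatP.
  by have [s Is [E|E]] := hglueP Iu; rewrite !E /=; [exact: h1|exact: h'1].
- move=> t It; have [x hx] := hv _ It; have [x' hx'] := h'v _ It.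
  have xx' : x' = x.
    by rewrite -(hx _ (I01_1 R)) ends// hx'//; exact: I01_0.
  exists x => u Iu; rewrite hhP.
  by have [s Is [E|E]] := hglueP Iu; rewrite E /= ?hx// hx'.
- move=> t It; rewrite !hhP hglue0 hglue1 /= !concatP hglue0 hglue1 /=.
  by rewrite (he _ It).1 (h'e _ It).2.
Qed.


(* Composition does not depend on the representatives: [f][g] = [fg]. *)
Lemma vcompE (f g : vpath) (fg : f 1 = g 0) (ab : vcomposable) :
  val ab = (vclass f, vclass g) -> vcomp ab = vclass (vconcat fg).
Proof.
move=> abE; apply/vclassP; apply: vconcat_vhomotopic; apply/vclassP.
  by rewrite vclass_repr abE.
by rewrite vclass_repr abE.
Qed.

End arrows.

(* Main.v *)
Require Import Defs.
From mathcomp Require Import all_boot all_order all_algebra.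
From mathcomp Require Import classical_sets reals topology.
From mathcomp Require Import functions set_interval normedtype lra.

Set Implicit Arguments.
Unset Strict Implicit.
Unset Printing Implicit Defensive.

Import Order.TTheory GRing.Theory Num.Theory numFieldNormedType.Exports.

Local Open Scope classical_set_scope.
Local Open Scope ring_scope.

(* Let f' and g' be composable and close to f and g, through squares h from f to
   f' and k from g to g'. The sides h(-,1) and k(-,0) are two paths in a
   small neighbourhood of y = f(1) = g(0), with the same end points y and
   f'(1) = g'(0). Their images in X bound a square inside a 1-connected basic
   open set, and by the sl1c property this square lifts to a square L whose
   sides are h(-,1), k(-,0) and two constant paths. Gluing h, L and k side by
   side gives a square from f * const * g to f' * const * g'; since f is
   vertically homotopic to f * const, the class of f'g' is close to that of
   fg. *)

(** * Basic neighbourhoods of a point; continuity of minima and maxima *)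

Lemma open_basis_sub (T : topologicalType) (B : open_basis T) (x : T)
    (A : set T) :
  nbhs x A -> exists V, [/\ B V, V x & V `<=` A].
Proof. by have [_ /(_ x A)] := basicP B => /[apply] -[V [BV Vx]]; exists V. Qed.

Lemma open_basis_nbhs (T : topologicalType) (B : open_basis T) (x : T)
    (V : set T) :
  B V -> V x -> nbhs x V.
Proof.
move=> BV Vx; apply: open_nbhs_nbhs; split => //.
by have [Bo _] := basicP B; exact: Bo.
Qed.

Lemma continuous_minf (R : realType) (T : topologicalType) (f g : T -> R) :
  continuous f -> continuous g -> continuous (fun x => Num.min (f x) (g x)).
Proof. by move=> cf cg x; exact: (@continuous_min R T f g x (cf x) (cg x)). Qed.

Lemma continuous_maxf (R : realType) (T : topologicalType) (f g : T -> R) :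
  continuous f -> continuous g -> continuous (fun x => Num.max (f x) (g x)).
Proof. by move=> cf cg x; exact: (@continuous_max R T f g x (cf x) (cg x)). Qed.

(** * Gluing squares along the path coordinate, and filling squares in simply connected sets *)

Section squares.
Context (R : realType) (T : topologicalType).
Implicit Types (a b : R -> T) (h k : R * R -> T).

(** Homotopy time is the first coordinate and the path parameter the second, so the swaps turn
    [hglue] into gluing along paths. The body repeats the function of [vglue_continuous], which
    therefore applies directly. *)
Definition vglue h k : R * R -> T :=
  hglue (h \o @swap_pair R R) (k \o @swap_pair R R) \o @swap_pair R R.

Lemma slice_continuous h (e : R) :
  I01 e -> {within I2, continuous h} ->
  {within I01, continuous (fun t => h (t, e))}.
Proof.
move=> Ie; apply: (within_comp (g := fun t : R => (t, e))) => //.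
apply: continuous_subspaceT; apply: pair_continuous => t; first exact: cvg_id.
exact: cvg_cst.
Qed.

Lemma vglue0 h k t : vglue h k (t, 0) = h (t, 0).
Proof. exact: hglue0. Qed.

Lemma vglue1 h k t : vglue h k (t, 1) = k (t, 1).
Proof. exact: hglue1. Qed.

(** Only one value of [t] is constrained, because the lemma serves to identify the ends [t = 0] and
    [t = 1] of a glued homotopy. *)
Lemma vglue_concat a b h k t u :
  (forall u, I01 u -> h (t, u) = a u) -> (forall u, I01 u -> k (t, u) = b u) ->
  I01 u -> vglue h k (t, u) = concat a b u.
Proof.
move=> ha kb; rewrite I01E => /andP[u0 u1]; rewrite /vglue /hglue /concat /=.
by case: leP => u2; [apply: ha|apply: kb]; rewrite I01E /=; lra.
Qed.

Lemma vglue_map_on (A : set T) h k :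
  map_on I2 A h -> map_on I2 A k -> (forall t, I01 t -> h (t, 1) = k (t, 0)) ->
  map_on I2 A (vglue h k).
Proof.
move=> [ch hA] [ck kA] hk; split; first exact: vglue_continuous.
by move=> z /I2_swap; apply: hglue_in => w /I2_swap; [exact: hA|exact: kA].
Qed.

Lemma concat_map_on (A : set T) a b :
  map_on I01 A a -> map_on I01 A b -> a 1 = b 0 -> map_on I01 A (concat a b).
Proof.
move=> [ca aA] [cb bA] ab.
have I2u u : I01 u -> I2 (u, 0 : R) by move=> Iu; split => //; exact: I01_0.
have -> : concat a b = hglue (a \o @fst R R) (b \o @fst R R) \o (fun u => (u, 0)).
  by [].
split.
  apply: slice_continuous; first exact: I01_0.
  by apply: hglue_continuous => //; exact: lift_fst_continuous.
by move=> u /I2u; apply: hglue_in => z [Iz _] /=; [exact: aA|exact: bA].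
Qed.

Lemma reverse_map_on (A : set T) a :
  map_on I01 A a -> map_on I01 A (fun u => a (1 - u)).
Proof.
move=> [ca aA].
have onemI (t : R) : I01 t -> I01 (1 - t).
  by rewrite !I01E => /andP[t0 t1]; rewrite subr_ge0 t1 gerBl t0.
split; last by move=> u /onemI; exact: aA.
apply: (within_comp (g := fun u : R => 1 - u)) onemI ca.
apply: continuous_subspaceT => u; apply: cvgB; first exact: cvg_cst.
exact: cvg_id.
Qed.

(* A null homotopy H of the loop a * b^-1 is only constant on three sides of its
   square; the filling is H o phi, where phi maps the bottom and top sides to
   the two halves of the side carrying the loop, the right side to its middle
   point, and the left side along the other three sides. *)
Lemma simply_connected_fill (U : set T) a b :
  simply_connected R U -> map_on I01 U a -> map_on I01 U b ->
  a 0 = b 0 -> a 1 = b 1 ->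
  exists c : R * R -> T,
    [/\ map_on I2 U c,
        (forall t, I01 t -> c (t, 0) = a t),
        (forall t, I01 t -> c (t, 1) = b t) &
        (forall u, I01 u -> c (0, u) = a 0 /\ c (1, u) = a 1)].
Proof.
move=> scU aU bU ab0 ab1.
pose l := concat a (fun u => b (1 - u)).
have lU : map_on I01 U l.
  by apply: concat_map_on => //; [exact: reverse_map_on|rewrite subr0].
have la t : t <= 1 -> l (t / 2) = a t.
  move=> t1; rewrite /l /concat ifT; last lra.
  by congr a; lra.
(* At [t = 1] the argument is the midpoint, where [concat] takes its first branch; there [a 1 = b 1]
   is what gives the value. *)
have lb t : t <= 1 -> l (1 - t / 2) = b t.
  move=> t1; rewrite /l /concat; case: leP => [?|_]; last by congr b; lra.
  have -> : t = 1 by lra.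
  by rewrite -ab1; congr a; lra.
have l0 : l 0 = a 0 by have := la _ ler01; rewrite mul0r.
have l1 : l 1 = a 0 by have := lb _ ler01; rewrite mul0r subr0 ab0.
have [|H [[cH HU] H0 H1 He]] := scU _ lU; first by rewrite l0 l1.
(* The path [u => (m u, v u)] runs from (0,0) through (1,0) and (1,1) to (0,1), one third of the
   time on each side. [phi] contracts it along straight segments to (0,1/2), the point where [H]
   takes the value [a 1]. *)
pose m (u : R) := Num.min 1 (Num.min (3 * u) (3 - 3 * u)).
pose v (u : R) := Num.max 0 (Num.min 1 (3 * u - 1)).
pose phi (z : R * R) := ((1 - z.1) * m z.2, (1 - z.1) * v z.2 + z.1 / 2).
have mI u : I01 u -> I01 (m u).
  by rewrite !I01E /m !minEle => /andP[? ?]; do 2?[case: ifP]; lra.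
have vI u : I01 u -> I01 (v u).
  by rewrite !I01E /v maxEle !minEle => /andP[? ?]; do 2?[case: ifP]; lra.
have phiI z : I2 z -> I2 (phi z).
  case: z => t u [/= It Iu].
  move: (mI _ Iu) (vI _ Iu) It.
  rewrite !I01E => /andP[? ?] /andP[? ?] /andP[? ?].
  by split; rewrite I01E /=; nra.
have cphi : continuous phi.
  have c1 : continuous (fun z : R * R => 1 - z.1).
    by move=> z; apply: cvgB; [exact: cvg_cst|exact: cvg_fst].
  have c2 (r : R) : continuous (fun z : R * R => r * z.2).
    by move=> z; apply: cvgM; [exact: cvg_cst|exact: cvg_snd].
  have c3 : continuous (fun z : R * R => m z.2).
    apply: continuous_minf => [z|]; first exact: cvg_cst.
    apply: continuous_minf => [|z]; first exact: c2.
    by apply: cvgB; [exact: cvg_cst|exact: c2].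
  have c4 : continuous (fun z : R * R => v z.2).
    apply: continuous_maxf => [z|]; first exact: cvg_cst.
    apply: continuous_minf => z; first exact: cvg_cst.
    by apply: cvgB; [exact: c2|exact: cvg_cst].
  apply: pair_continuous => z; first by apply: cvgM; [exact: c1|exact: c3].
  apply: cvgD; first by apply: cvgM; [exact: c1|exact: c4].
  by apply: cvgM; [exact: cvg_fst|exact: cvg_cst].
exists (H \o phi); split.
- split; last by move=> z Iz; exact/HU/phiI.
  by apply: within_comp phiI cH; exact: continuous_subspaceT.
- move=> t; rewrite I01E => /andP[t0 t1].
  rewrite /comp; have -> : phi (t, 0) = (0, t / 2).
    by rewrite /phi /m /v /= maxEle !minEle; congr pair; do 2?[case: ifP]; nra.
  by rewrite H0 ?la// I01E; lra.
- move=> t; rewrite I01E => /andP[t0 t1].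
  rewrite /comp; have -> : phi (t, 1) = (0, 1 - t / 2).
    by rewrite /phi /m /v /= maxEle !minEle; congr pair; do 2?[case: ifP]; nra.
  by rewrite H0 ?lb// I01E; lra.
- move=> u Iu; split; last first.
    rewrite /comp; have -> : phi (1, u) = (0, 1 / 2).
      by rewrite /phi /=; congr pair; lra.
    by rewrite H0 ?la// I01E; lra.
  rewrite /comp; have -> : phi (0, u) = (m u, v u).
    by rewrite /phi /=; congr pair; lra.
  have := mI _ Iu; have := vI _ Iu; move: Iu.
  rewrite I01E => /andP[u0 u1] Iv Im; rewrite -l0.
  (* By thirds of the parameter, the point lies on the side [v u = 0], [v u = 1] or [m u = 1]; [H]
     is constantly [l 0] on each. *)
  have [u3|u3] := leP (3 * u) 1.
    have -> : v u = 0 by rewrite /v maxEle minEle; do 2?[case: ifP]; lra.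
    exact: (He _ Im).1.
  have [u3'|u3'] := leP 2 (3 * u).
    have -> : v u = 1 by rewrite /v maxEle minEle; do 2?[case: ifP]; lra.
    exact: (He _ Im).2.
  have -> : m u = 1 by rewrite /m !minEle; do 2?[case: ifP]; lra.
  exact: H1.
Qed.

End squares.

(** * Lifting squares through a semilocally 1-connected map *)

Lemma bdI2_sides_continuous (R : realType) (T : topologicalType)
    (a b : R -> T) :
  {within I01, continuous a} -> {within I01, continuous b} ->
  a 0 = b 0 -> a 1 = b 1 ->
  {within bdI2, continuous (fun z : R * R => if z.2 <= 2^-1 then a z.1 else b z.1)}.
Proof.
move=> ca cb ab0 ab1.
have csnd : continuous (@snd R R) by move=> z; exact: cvg_snd.
have cfst : continuous (@fst R R) by move=> z; exact: cvg_fst.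
have cle (r : R) : closed [set z : R * R | z.2 <= r].
  by apply: (closed_comp (f := snd)) (@closed_le _ r) => z _; exact: csnd.
have cge (r : R) : closed [set z : R * R | z.2 >= r].
  by apply: (closed_comp (f := snd)) (@closed_ge _ r) => z _; exact: csnd.
have ceq1 (r : R) : closed [set z : R * R | z.1 = r].
  by apply: (closed_comp (f := fst)) (@closed_eq _ r) => z _; exact: cfst.
have ceq2 (r : R) : closed [set z : R * R | z.2 = r].
  by apply: (closed_comp (f := snd)) (@closed_eq _ r) => z _; exact: csnd.
have cI : closed (I2 : set (R * R)).
  by apply: closedI; apply: closed_comp; try exact: interval_closed; move=> z _;
    [exact: cfst|exact: csnd].
have cbd : closed (bdI2 : set (R * R)).
  have -> : (bdI2 : set (R * R)) = I2 `&`
      ([set z | z.1 = 0] `|` [set z | z.1 = 1] `|`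
       [set z | z.2 = 0] `|` [set z | z.2 = 1]).
    apply/seteqP; split => z [Iz].
      by case=> ?; split => //; [left; left; left|left; left; right|left; right|right].
    by case=> [[[]|]|] ?; split => //; [exact: Or41|exact: Or42|exact: Or43|exact: Or44].
  by apply: closedI => //; do 3?[apply: closedU => //].
have fstI (z : R * R) : bdI2 z -> I01 z.1 by case=> -[].
have -> : (bdI2 : set (R * R)) =
    (bdI2 `&` [set z | z.2 <= 2^-1]) `|` (bdI2 `&` [set z | z.2 >= 2^-1]).
  rewrite -setIUr; apply/seteqP; split => [z Iz|z []//]; split => //=.
  by case: (leP z.2 2^-1) => [|/ltW]; [left|right].
apply: withinU_continuous; [exact: closedI|exact: closedI| |].
- apply: (@subspace_eq_continuous _ _ _ (a \o fst)).
    by move=> z; rewrite inE => -[_ /= zle]; rewrite /from_subspace /= zle.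
  by apply: within_comp ca; [exact: continuous_subspaceT|move=> z [/fstI]].
- apply: (@subspace_eq_continuous _ _ _ (b \o fst)).
    move=> z; rewrite inE => -[[_ zbd] /= zge]; rewrite /from_subspace /=.
    (* The two closed pieces meet at height 1/2, where a boundary point has first coordinate 0 or 1
       and [a] and [b] agree. *)
    case: leP => // zle; case: zbd => [->|->|z0|z1] //.
      by exfalso; move: zge; rewrite z0; lra.
    by exfalso; move: zle; rewrite z1; lra.
  by apply: within_comp cb; [exact: continuous_subspaceT|move=> z [/fstI]].
Qed.

(** The open set [W] that [sl1c] provides may leave [U], so it is shrunk to a basic [U'] inside
    both, still 1-connected. Choosing [N] over [U'] makes the images of [a] and [b] bound a square
    in [U'], which is then lifted. *)
Lemma sl1c_fill (R : realType) (X Y : topologicalType)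
    (BX : open_basis X) (BY : open_basis Y) (p : Y -> X) (y : Y) (U : set X) :
  continuous p -> locally_one_connected R BX -> sl1c R BX BY p ->
  BX U -> U (p y) ->
  exists (U' : set X) (N : set Y),
    [/\ BX U', U' (p y), U' `<=` U, BY N & N y] /\
    forall a b : R -> Y,
      map_on I01 N a -> map_on I01 N b -> a 0 = b 0 -> a 1 = b 1 ->
      exists l : R * R -> Y,
        [/\ map_on I2 (p @^-1` U') l,
            (forall t, I01 t -> l (t, 0) = a t),
            (forall t, I01 t -> l (t, 1) = b t) &
            (forall u, I01 u -> l (0, u) = a 0 /\ l (1, u) = a 1)].
Proof.
move=> cp lX sp BU Uy.
have [W [M [[BW Wy BM My MW] ext]]] := sp y.
have [U' [BU' U'y U'UW]] : exists V, [/\ BX V, V (p y) & V `<=` U `&` W].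
  apply: open_basis_sub; apply: filterI; first exact: open_basis_nbhs BU Uy.
  exact: open_basis_nbhs BW Wy.
have [N [BN Ny NM]] : exists V, [/\ BY V, V y & V `<=` M `&` p @^-1` U'].
  apply: open_basis_sub; apply: filterI; first exact: open_basis_nbhs BM My.
  by apply: cp; exact: open_basis_nbhs BU' U'y.
exists U', N; split; first by split => // x /U'UW[].
move=> a b [ca aN] [cb bN] ab0 ab1.
have pathU (e : R -> Y) : {within I01, continuous e} ->
    (forall t, I01 t -> N (e t)) -> map_on I01 U' (p \o e).
  move=> ce eN; split; last by move=> t /eN/NM[].
  apply: (within_comp (B := setT)) ce _ _ => //.
  exact: continuous_subspaceT.
have [_ scU'] := lX _ BU'.
have [||c [[cc cU'] ca' cb' cend]] := simply_connected_fill scU'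
    (pathU _ ca aN) (pathU _ cb bN); [by rewrite /= ab0|by rewrite /= ab1|].
(* Boundary data of the lift: [a] below, [b] above, and on the vertical sides both branches give the
   same constant. *)
pose w (z : R * R) := if z.2 <= 2^-1 then a z.1 else b z.1.
have w0 t : w (t, 0) = a t by rewrite /w /= ifT//; lra.
have w1 t : w (t, 1) = b t by rewrite /w /= ifF//; lra.
have wl u : w (0, u) = a 0 by rewrite /w /= ab0 if_same.
have wr u : w (1, u) = a 1 by rewrite /w /= ab1 if_same.
have [|||l [[cl lW] pl lw]] := ext w c.
- split; first exact: bdI2_sides_continuous.
  by move=> [t u] [[/= It _] _]; rewrite /w /=; case: ifP => _;
    [have /NM[] := aN _ It|have /NM[] := bN _ It].
- by split => // z /cU'/U'UW[].
- move=> [t u] [[/= It Iu]] [] /= ->; rewrite ?w0 ?w1 ?wl ?wr.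
  + exact: (cend _ Iu).1.
  + exact: (cend _ Iu).2.
  + exact: ca'.
  + exact: cb'.
have I0 := I01_0 R; have I1 := I01_1 R.
exists l; split.
(* The lift is given only over [W]; since it covers [c], it lies over [U']. *)
- by split => // z Iz; rewrite /= pl//; exact: cU'.
- by move=> t It; rewrite lw ?w0//; split => //; exact: Or43.
- by move=> t It; rewrite lw ?w1//; split => //; exact: Or44.
- by move=> u Iu; rewrite !lw ?wl ?wr//; split => //; [exact: Or42|exact: Or41].
Qed.

(** * End points of a concatenation, and paths that end by waiting *)

Lemma vconcat0 (R : realType) (X Y : topologicalType) (p : Y -> X)
    (f g : vpath R p) (fg : f 1 = g 0) :
  vconcat fg 0 = f 0.
Proof. by rewrite /= /concat mulr0 ifT//; lra. Qed.

Lemma vconcat1 (R : realType) (X Y : topologicalType) (p : Y -> X)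
    (f g : vpath R p) (fg : f 1 = g 0) :
  vconcat fg 1 = g 1.
Proof. by rewrite /= /concat ifF; [congr (g _)|]; lra. Qed.

Section stall.
Context (R : realType) (X Y : topologicalType) (p : Y -> X).
Implicit Types f g : vpath R p.

Let slow (r : R) (u : R) : R := Num.min 1 (r * u).

Let slowI (r u : R) : 0 <= r -> I01 u -> I01 (slow r u).
Proof.
move=> r0; rewrite !I01E /slow minEle => /andP[u0 u1].
by case: ifP => ru; [lra|rewrite mulr_ge0//=; lra].
Qed.

Lemma stall_continuous f :
  {within I01, continuous (fun u => f (Num.min 1 (2 * u)))}.
Proof.
apply: (within_comp (g := slow 2)) (vpath_continuous f).
  apply: continuous_subspaceT; apply: continuous_minf => u; first exact: cvg_cst.
  by apply: cvgM; [exact: cvg_cst|exact: cvg_id].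
by move=> u; exact: slowI.
Qed.

Lemma stall_vertical f :
  exists x : X, forall u, I01 u -> p (f (Num.min 1 (2 * u))) = x.
Proof.
have [x fx] := vpath_vertical f; exists x => u Iu.
by apply: fx; exact: (@slowI 2).
Qed.

(** This is [f] followed by the constant path at [f 1], written as a reparametrisation so that
    continuity and verticality are inherited from [f]. *)
Definition stall f : vpath R p := VPath (@stall_continuous f) (@stall_vertical f).

(** The speed of [slow] grows from 1 to 2. It never drops below 1, so the end point is always
    reached, and every intermediate path takes its values along [f], hence is vertical. *)
Lemma vhomotopic_stall f : vhomotopic f (stall f).
Proof.
have I1 := I01_1 R.
have ge01 (t : R) : I01 t -> 0 <= 1 + t by rewrite I01E => /andP[? ?]; lra.
exists (fun z => f (slow (1 + z.1) z.2)); split.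
- apply: (within_comp (g := fun z : R * R => slow (1 + z.1) z.2))
    (vpath_continuous f).
    apply: continuous_subspaceT; apply: continuous_minf => z; first exact: cvg_cst.
    apply: cvgM; last exact: cvg_snd.
    by apply: cvgD; [exact: cvg_cst|exact: cvg_fst].
  by move=> z [Iz1 Iz2]; apply: slowI => //; exact: ge01.
- move=> u; rewrite I01E => /andP[u0 u1]; rewrite /slow /= addr0 mul1r.
  by rewrite min_r.
- by [].
- move=> t It; have [x fx] := vpath_vertical f; exists x => u Iu.
  by apply: fx; apply: slowI => //; exact: ge01.
- move=> t; rewrite I01E => /andP[t0 t1]; rewrite /slow /=.
  by rewrite mulr0 min_r// mulr1 min_l//; lra.
Qed.

Lemma stall1 f : stall f 1 = f 1.
Proof. by have [] := vhomotopic_ends (vhomotopic_stall f). Qed.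

Lemma stallE f (h l : R * R -> Y) t u :
  (forall u, I01 u -> h (t, u) = f u) -> (forall u, I01 u -> l (t, u) = f 1) ->
  I01 u -> vglue h l (t, u) = stall f u.
Proof.
move=> hf lf Iu; rewrite (vglue_concat (a := f) (b := fun=> f 1))// /concat /=.
by case: leP => u2; [rewrite min_r//; lra|rewrite min_l//; lra].
Qed.

End stall.

(** * Neighbourhoods in the space of arrows *)

Section nbhd.
Context (R : realType) (X Y : topologicalType).
Context (BX : open_basis X) (BY : open_basis Y) (p : Y -> X).
Local Notation vpath := (vpath R p).
Local Notation vclass := (@vclass R X Y BX BY p).
Local Notation vpi1_nbhd := (@vpi1_nbhd R X Y BX BY p).

Lemma vpi1_nbhd_ends (f g : vpath) U V0 V1 :
  vpi1_nbhd f U V0 V1 (vclass g) -> [/\ U (p (g 0)), V0 (g 0) & V1 (g 1)].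
Proof.
case=> k [h [[_ hU] _ hk hV]] /vclassP/vhomotopic_ends[<- <-].
have I0 := I01_0 R; have I1 := I01_1 R.
have [V0k V1k] := hV _ I1; rewrite -!hk//.
by split => //; exact: hU.
Qed.

Lemma vpi1_nbhd_concat (f g f' g' : vpath) (fg : f 1 = g 0)
    (fg' : f' 1 = g' 0) (U : set X) (V0 V1 : set Y) (h k l : R * R -> Y) :
  map_on I2 (p @^-1` U) h -> map_on I2 (p @^-1` U) k ->
  map_on I2 (p @^-1` U) l ->
  (forall u, I01 u -> h (0, u) = f u /\ h (1, u) = f' u) ->
  (forall u, I01 u -> k (0, u) = g u /\ k (1, u) = g' u) ->
  (forall u, I01 u -> l (0, u) = f 1 /\ l (1, u) = f' 1) ->
  (forall t, I01 t -> l (t, 0) = h (t, 1) /\ l (t, 1) = k (t, 0)) ->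
  (forall t, I01 t -> V0 (h (t, 0)) /\ V1 (k (t, 1))) ->
  vpi1_nbhd (vconcat fg) U V0 V1 (vclass (vconcat fg')).
Proof.
move=> mh mk ml hf kg lf lhk hkV.
have I0 := I01_0 R; have I1 := I01_1 R.
have sfg : stall f 1 = g 0 by rewrite stall1.
have sfg' : stall f' 1 = g' 0 by rewrite stall1.
have Uh : U (p (f 0)) by rewrite -(hf _ I0).1; exact: mh.2.
have V0f : V0 (f 0) by rewrite -(hf _ I0).1; exact: (hkV _ I0).1.
have V1g : V1 (g 1) by rewrite -(kg _ I1).1; exact: (hkV _ I0).2.
(* The glued square joins the concatenations of stalled paths. Stalling does not change the class,
   so [vpi1_nbhd_sub] moves the centre of the neighbourhood; the target class is rewritten
   likewise. *)
have : vpi1_nbhd (vconcat fg) U V0 V1 (vclass (vconcat sfg)).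
  have <- : vclass (vconcat fg) = vclass (vconcat sfg).
    apply/vclassP; apply: vconcat_vhomotopic; first exact: vhomotopic_stall.
    exact: vhomotopic_refl.
  by apply: vpi1_nbhd_self; rewrite ?vconcat0 ?vconcat1.
move=> /vpi1_nbhd_sub; apply; try exact: subset_refl.
have -> : vclass (vconcat fg') = vclass (vconcat sfg').
  apply/vclassP; apply: vconcat_vhomotopic; first exact: vhomotopic_stall.
  exact: vhomotopic_refl.
exists (vconcat sfg') => //; exists (vglue (vglue h l) k); split.
- apply: vglue_map_on => //.
    by apply: vglue_map_on => // t It; rewrite (lhk _ It).1.
  by move=> t It; rewrite vglue1 (lhk _ It).2.
- move=> u Iu; apply: vglue_concat Iu => [u'|u' /kg[]//].
  by apply: stallE => u'' I''; [exact: (hf _ I'').1|exact: (lf _ I'').1].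
- move=> u Iu; apply: vglue_concat Iu => [u'|u' /kg[]//].
  by apply: stallE => u'' I''; [exact: (hf _ I'').2|exact: (lf _ I'').2].
- by move=> t It; rewrite !vglue0 vglue1; exact: hkV.
Qed.

Lemma nbhs_vpi1_nbhd (f : vpath) U V0 V1 :
  BX U -> U (p (f 0)) -> BY V0 -> V0 (f 0) -> BY V1 -> V1 (f 1) ->
  nbhs (vclass f) (vpi1_nbhd f U V0 V1).
Proof.
move=> BU Uf BV0 V0f BV1 V1f; apply: open_nbhs_nbhs; split.
  exists [set vpi1_nbhd f U V0 V1]; last exact: bigcup_set1.
  by move=> _ ->; exists f, U, V0, V1.
exact: vpi1_nbhd_self.
Qed.

(** A basic open set around the class of [f] may be centred at another path [k]; [vpi1_nbhd_sub]
    recentres it at [f] with the same [U], [V0], [V1]. *)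
Lemma nbhs_vpi1_sub (f : vpath) (W : set (@vpi1 R X Y BX BY p)) :
  nbhs (vclass f) W -> exists U V0 V1,
    [/\ BX U /\ U (p (f 0)), BY V0 /\ V0 (f 0), BY V1 /\ V1 (f 1) &
        vpi1_nbhd f U V0 V1 `<=` W].
Proof.
rewrite nbhsE => -[O [[Bs sB <-] [A BsA Af]] OW].
have [k [U [V0 [V1 [AE [BU _] [BV0 _] [BV1 _]]]]]] := sB _ BsA.
have {}Af : vpi1_nbhd k U V0 V1 (vclass f) by rewrite -AE.
have [Uf V0f V1f] := vpi1_nbhd_ends Af.
exists U, V0, V1; split => //.
apply: subset_trans (vpi1_nbhd_sub Af _ _ _) _; try exact: subset_refl.
by rewrite -AE => x Ax; apply: OW; exists A.
Qed.

End nbhd.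

(** * Continuity of composition at a composable pair *)

Theorem lemma3p2 (R : realType) (X Y : topologicalType)
    (BX : open_basis X) (BY : open_basis Y) (p : Y -> X) :
  continuous p ->
  locally_one_connected R BX ->
  sl1c R BX BY p ->
  continuous (@vcomp R X Y BX BY p).
Proof.
move=> cp lX sp ab W.
have I0 := I01_0 R; have I1 := I01_1 R.
set f := repr (val ab).1; set g := repr (val ab).2.
have fg : f 1 = g 0 := vcomposable_repr ab.
move=> /nbhs_vpi1_sub[U [V0 [V1]]].
rewrite !vconcat0 vconcat1 => -[[BU Uf] [BV0 V0f] [BV1 V1g] UW].
have Uf1 : U (p (f 1)) by rewrite vpathE.
have [U' [N [[BU' U'f U'U BN Nf] fill]]] := sl1c_fill cp lX sp BU Uf1.
(* The same [N] controls the target in [A] and the source in [B], so both inner sides of the squares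
   stay in [N], as [fill] requires. *)
pose A := @vpi1_nbhd R X Y BX BY p f U' V0 N.
pose B := @vpi1_nbhd R X Y BX BY p g U' N V1.
have : nbhs ab (val @^-1` (A `*` B)).
  have /(_ ab) cval := @initial_continuous _ _ (@set_val _ (@vcomposable R X Y BX BY p)).
  apply: (cval (A `*` B)).
  exists (A, B) => //=.
  rewrite -(vclass_repr (val ab).1) -(vclass_repr (val ab).2) -/f -/g.
  split; apply: nbhs_vpi1_nbhd; rewrite -?fg//.
  by rewrite -(vpathE f I1).
apply: (@filterS _ _ (nbhs_filter ab)) => cd [[f' [h [[ch hU'] hf hf' hV]] f'E]].
move=> [g' [k [[ck kU'] kg kg' kV]] g'E].
(* Here [f'] and [g'] are arbitrary representatives; they are composable because end points depend
   only on the class. *)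
have fg' : f' 1 = g' 0.
  rewrite -(vtarget_class BX BY f') -(vsource_class BX BY g') f'E g'E.
  exact: set_mem (valP cd).
have cdE : val cd = (vclass BX BY f', vclass BX BY g').
  by rewrite f'E g'E; case: (val cd).
rewrite /= (vcompE fg' cdE); apply: UW.
have [||||l [[cl lU'] lh lk lend]] :=
    fill (fun t => h (t, 1)) (fun t => k (t, 0)).
- split; last by move=> t /hV[].
  exact: slice_continuous I1 ch.
- split; last by move=> t /kV[].
  exact: slice_continuous I0 ck.
- by rewrite hf// kg.
- by rewrite hf'// kg'.
apply: (@vpi1_nbhd_concat _ _ _ BX BY p f g f' g' _ fg' U V0 V1 h k l).
- by split => // z /hU'/U'U.
- by split => // z /kU'/U'U.
- by split => // z /lU'/U'U.
- by move=> u Iu; rewrite hf ?hf'.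
- by move=> u Iu; rewrite kg ?kg'.
- by move=> u /lend; rewrite hf ?hf'.
- by move=> t It; rewrite lh ?lk.
- by move=> t It; split; [have [] := hV _ It|have [] := kV _ It].
Qed.
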